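(* Let $(\mathcal{X},\mathcal{B})$ be any Steiner system $S(t,k,n)$ with point set $\mathcal{X}=[0,n-1]$. Then its max-sum satisfies $$\max_{B\in\mathcal{B}}\ \sum_{x\in B}x\ \ge\ \frac{nk+nt-n-kt}{2}.$$
   Context: For integers $a\le b$, $[a,b]=\{a,a+1,\ldots,b\}$. A Steiner system $S(t,k,n)$ (a $t$-$(n,k,1)$ design), where $1\le t\le k\le n$ are integers, is a pair $(\mathcal{X},\mathcal{B})$ where $\mathcal{X}$ is an $n$-set of points and $\mathcal{B}$ is a collection of $k$-subsets of $\mathcal{X}$ (blocks) such that every $t$-subset of $\mathcal{X}$ is contained in exactly one block. Here the points are the integers $0,\ldots,n-1$. The max-sum of the design is the maximum over blocks $B\in\mathcal{B}$ of the block-sum $\sum_{x\in B}x$. *)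

(* Defs.v *)
From mathcomp Require Import all_boot all_order all_algebra.

Set Implicit Arguments.
Unset Strict Implicit.
Unset Printing Implicit Defensive.

(* (T, Bs) is a Steiner system S(t, k, n); the points are all the elements of
   the finite type T.  The standing assumption 1 <= t <= k <= n is not
   included here. *)
Definition steiner_system (t k n : nat) (T : finType) (Bs : {set {set T}})
  : Prop :=
  [/\ #|T| = n,
      forall B : {set T}, B \in Bs -> #|B| = k
    & forall S : {set T}, #|S| = t ->
        exists! B : {set T}, B \in Bs /\ S \subset B].

Definition block_sum (n : nat) (B : {set 'I_n}) : nat := \sum_(x in B) x.

(* The maximum over an empty collection is 0; a Steiner system with t <= n
   has at least one block, so this convention plays no role for it. *)
Definition max_sum (n : nat) (Bs : {set {set 'I_n}}) : nat :=
  \max_(B in Bs) block_sum B.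

(* Main.v *)
(* Let S consist of the t - 1 largest points.  The blocks containing S, with S
   removed, partition the other points 0, ..., n - t.  Give the point x the
   weight 2x - (n - t): the points outside S have total weight 0, so some block
   containing S has nonnegative weight outside S.  Its whole weight is then at
   least that of S, which is n (t - 1); its block-sum is half of the weight
   plus k (n - t) / 2. *)
Require Import Defs.
From mathcomp Require Import all_boot all_order all_algebra.
From mathcomp Require Import ring lra zify.
Import Order.TTheory GRing.Theory Num.Theory.
Local Open Scope ring_scope.

(** After exchanging the sums, each [x] outside [S] is counted once: [x |: S] has [t.+1] points, so
    exactly one block contains it. *)
Lemma sum_derived_blocks (V : nmodType) (t k n : nat) (T : finType)
    (Bs : {set {set T}}) (S : {set T}) (F : T -> V) :
    steiner_system t.+1 k n Bs -> #|S| = t ->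
  \sum_(B in Bs | S \subset B) \sum_(x in B :\: S) F x = \sum_(x in ~: S) F x.
Proof.
move=> [_ _ hS] cS.
rewrite (exchange_big_dep (mem (~: S))) /=; last first.
  by move=> B x _; rewrite !inE => /andP[].
apply: eq_bigr => x; rewrite inE => xS.
have [|B [[BBs xSB] uB]] := hS (x |: S); first by rewrite cardsU1 xS cS.
rewrite (big_pred1 B) // => B'; rewrite !inE xS /=.
apply/idP/eqP => [/andP[/andP[B'Bs SB'] xB']|->].
  by apply/esym/uB; split=> //; rewrite subUset sub1set xB'.
by move: xSB; rewrite subUset sub1set BBs => /andP[-> ->].
Qed.

Lemma sum_centered (R : comPzRingType) (m j : nat) :
  \sum_(i < j) (2 * i%:R - m%:R) = j%:R * (j%:R - 1 - m%:R) :> R.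
Proof.
elim: j => [|j IHj]; first by rewrite big_ord0 mul0r.
by rewrite big_ord_recr /= IHj -natr1; ring.
Qed.

(** The witness [i0] excludes the empty sum, which is also nonnegative. *)
Lemma exists_sum_ge0 (R : realDomainType) (I : finType) (P : pred I)
    (F : I -> R) (i0 : I) :
  P i0 -> 0 <= \sum_(i | P i) F i -> exists2 i, P i & 0 <= F i.
Proof.
move=> Pi0 sum_ge0.
case: (pickP (fun i => P i && (0 <= F i))) => [i /andP[]|F_lt0]; first by exists i.
have Flt0 i : P i -> F i < 0.
  by move=> Pi; move: (F_lt0 i); rewrite Pi /= leNgt => /negbFE.
move: sum_ge0; rewrite leNgt (bigD1 i0) //= ltr_wnDr ?Flt0 //.
by apply: sumr_le0 => i /andP[Pi _]; apply/ltW/Flt0.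
Qed.

Theorem proposition2 (t k n : nat) (ht : (1 <= t)%N) (htk : (t <= k)%N)
    (hkn : (k <= n)%N) (Bs : {set {set 'I_n}})
    (hBs : steiner_system t k n Bs) :
  (n%:R * k%:R + n%:R * t%:R - n%:R - k%:R * t%:R) / 2%:R
    <= (max_sum Bs)%:R :> rat.
Proof.
case: t ht htk hBs => // u _ htk hBs.
(* With [t = u.+1], [m] is n - t, the largest point outside [S]. *)
have [m nE] : exists m, n = (m + u.+1)%N by exists (n - u.+1)%N; lia.
have [_ cB hS] := hBs.
pose S := [set x : 'I_n | (m < x)%N].
pose W (x : 'I_n) : rat := 2 * x%:R - m%:R.
have mn : (m.+1 <= n)%N by lia.
have sumSC (V : nmodType) (F : nat -> V) :
    \sum_(x in ~: S) F x = \sum_(i < m.+1) F i.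
  rewrite [RHS](big_ord_widen _ _ mn).
  by apply: eq_bigl => x; rewrite !inE -leqNgt.
have cS : #|S| = u.
  have cSC : #|~: S| = m.+1.
    by rewrite -sum1_card (sumSC nat (fun=> 1%N)) sum1_card card_ord.
  by have := cardsC S; rewrite cSC card_ord; lia.
have WSC : \sum_(x in ~: S) W x = 0.
  rewrite (sumSC _ (fun i => 2 * i%:R - m%:R)) sum_centered -natr1.
  by ring.
(* Since [~: S] has weight 0, [S] carries the total weight n (n - 1 - m) = n u. *)
have WS : \sum_(x in S) W x = n%:R * u%:R.
  transitivity (\sum_x W x).
    rewrite [RHS](bigID (mem S)) /= [X in _ = _ + X](eq_bigl (mem (~: S))) ?WSC ?addr0 //.
    by move=> x; rewrite !inE.
  by rewrite sum_centered nE natrD -natr1; ring.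
(* Adding the point [m] to [S] gives [u.+1] points, so at least one block contains [S]. *)
have [|B0 [[B0Bs SB0] _]] := hS (Ordinal mn |: S).
  by rewrite cardsU1 cS inE ltnn.
have [||B /andP[BBs SB] WB] := @exists_sum_ge0 _ _
    (fun B => (B \in Bs) && (S \subset B)) (fun B => \sum_(x in B :\: S) W x) B0.
- by rewrite B0Bs (subset_trans _ SB0) ?subsetUr.
- by rewrite (sum_derived_blocks _ _ _ _ _ _ _ _ hBs cS) WSC.
have WBE : \sum_(x in B) W x = 2 * (block_sum B)%:R - k%:R * m%:R.
  rewrite sumrB -mulr_sumr -natr_sum sumr_const cB //.
  by rewrite -[_ *+ k]mulr_natl.
have WBS : n%:R * u%:R <= \sum_(x in B) W x.
  by rewrite (big_setID S) /= (setIidPr SB) WS lerDl.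
have BM : (block_sum B)%:R <= (max_sum Bs)%:R :> rat.
  by rewrite ler_nat /max_sum (leq_bigmax_cond B).
have nR : n%:R = m%:R + u%:R + 1 :> rat by rewrite nE natrD -natr1 addrA.
move: WBS; rewrite WBE -[u.+1%:R]natr1 => WBS.
(* For n = m + u + 1 the numerator equals n u + k m, which [WBS] bounds by twice the block-sum of
   [B]. *)
rewrite ler_pdivrMr // nR in WBS *.
by nra.
Qed.
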